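(* Let $K$ be a field of characteristic $0$, $V$ a finite dimensional $K$-vector space, and $g=a_0u^m+a_1u^{m-1}+\dots+a_m\in\operatorname{End}(V)[u]$ a polynomial of degree $m\geq 1$ with coefficients in $\operatorname{End}(V)$ whose leading coefficient $a_0$ is invertible. Let $h\in\operatorname{End}(V)[u]$, and let $\phi(h):V[u]/gV[u]\to V[u]/gV[u]$ be the $K$-linear map $p\circ h\circ\sigma$. Then $$\operatorname{Tr}_{V[u]/gV[u]}(\phi(h))=-\operatorname{Tr}_V\operatorname{res}_{u=\infty}(dg\,g^{-1}h).$$
   Context: $V[u]=V\otimes_KK[u]$, on which $\operatorname{End}(V)[u]$ acts on the left ($u$ central). $p:V[u]\to V[u]/gV[u]$ is the projection. Since $a_0$ is invertible, $V\oplus Vu\oplus\dots\oplus Vu^{m-1}\subset V[u]$ maps isomorphically onto $V[u]/gV[u]$, and $\sigma:V[u]/gV[u]\hookrightarrow V[u]$ is the inverse isomorphism followed by this inclusion; $h$ acts as left multiplication on $V[u]$. $g$ is invertible in $\operatorname{End}(V)((u^{-1}))$, $dg=\frac{dg}{du}du$, and $\operatorname{res}_{u=\infty}$ of $\big(\sum_nc_nu^n\big)du$, $c_n\in\operatorname{End}(V)$, is the usual residue at infinity, equal to $-c_{-1}$. *)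

(* Defs.v *)
From HB Require Import structures.
From mathcomp Require Import all_boot all_order all_algebra.
From mathcomp Require Import all_classical.
From mathcomp Require Import ring_quotient.

Set Implicit Arguments.
Unset Strict Implicit.
Unset Printing Implicit Defensive.

Import Order.TTheory GRing.Theory Num.Theory.
Local Open Scope classical_set_scope.
Local Open Scope ring_scope.
Local Open Scope quotient_scope.

(* [upoly M] is M[u] = M (x)_K K[u], with an element given by its finitely
   supported sequence of coefficients. {poly 'End(V)} is not used because
   MathComp makes 'End(V) a ring only for V <> 0, and because V[u] is needed
   as well. *)
Section PolynomialsWithCoefficientsInAModule.
Variables (K : nzRingType) (M : lmodType K).

Definition finite_degree : {pred nat -> M} :=
  [pred c : nat -> M | `[< exists n, forall k, (n <= k)%N -> c k = 0 >]].

Lemma finite_degree_closed : submod_closed finite_degree.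
Proof.
split=> [|a c d /asboolP[n cn] /asboolP[p dp]]; apply/asboolP.
  by exists 0%N.
exists (maxn n p) => k; rewrite geq_max => /andP[nk pk].
by rewrite -[LHS]/(a *: c k + d k) cn // dp // scaler0 addr0.
Qed.

HB.instance Definition _ :=
  GRing.isSubmodClosed.Build K (nat -> M) finite_degree finite_degree_closed.

Record upoly := UPoly { ucoef :> nat -> M; _ : ucoef \in finite_degree }.

HB.instance Definition _ := [isSub for ucoef].
HB.instance Definition _ := [Choice of upoly by <:].
HB.instance Definition _ := [SubChoice_isSubLmodule of upoly by <:].

Lemma upolyP (p q : upoly) : (forall k, p k = q k) <-> p = q.
Proof. by split=> [pq|-> //]; apply/val_inj/funext. Qed.

Lemma upoly_degree (p : upoly) :
  exists n, forall k, (n <= k)%N -> p k = 0.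
Proof. by have /asboolP := valP p. Qed.

Lemma umonom_subproof (x : M) (n : nat) :
  (fun k => if k == n then x else 0) \in finite_degree.
Proof. by apply/asboolP; exists n.+1 => k; case: ltngtP. Qed.

(* x u^n *)
Definition umonom (x : M) (n : nat) : upoly := UPoly (umonom_subproof x n).

Lemma uderiv_subproof (p : upoly) :
  (fun k => p k.+1 *+ k.+1) \in finite_degree.
Proof.
have [n pn] := upoly_degree p; apply/asboolP; exists n => k nk.
by rewrite pn ?mul0rn// (leq_trans nk).
Qed.

Definition uderiv (p : upoly) : upoly := UPoly (uderiv_subproof p).

End PolynomialsWithCoefficientsInAModule.

Section LaurentSeriesAtInfinity.
Variables (K : fieldType) (V : vectType K).

Definition bounded_above : {pred int -> 'End(V)} :=
  [pred c : int -> 'End(V) | `[< exists N, forall k, N < k -> c k = 0 >]].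

Lemma bounded_above_closed : submod_closed bounded_above.
Proof.
split=> [|a c d /asboolP[n cn] /asboolP[p dp]]; apply/asboolP.
  by exists 0.
exists (Order.max n p) => k; rewrite gt_max => /andP[nk pk].
by rewrite -[LHS]/(a *: c k + d k) cn // dp // scaler0 addr0.
Qed.

HB.instance Definition _ := GRing.isSubmodClosed.Build K (int -> 'End(V))
  bounded_above bounded_above_closed.

(* End(V)((u^-1)): the formal sums \sum_n c_n u^n, n in Z, with c_n = 0 for n
   large *)
Record laurent :=
  Laurent { lcoef :> int -> 'End(V); _ : lcoef \in bounded_above }.

HB.instance Definition _ := [isSub for lcoef].
HB.instance Definition _ := [Choice of laurent by <:].
HB.instance Definition _ := [SubChoice_isSubLmodule of laurent by <:].

Lemma laurent_bound (c : laurent) : exists N, forall k, N < k -> c k = 0.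
Proof. by have /asboolP := valP c. Qed.

Lemma laurent_of_upoly_subproof (p : upoly 'End(V)) :
  (fun n : int => if n is Posz k then p k else 0) \in bounded_above.
Proof.
have [n pn] := upoly_degree p; apply/asboolP; exists n%:Z => -[k|k] // nk.
by rewrite pn // ltnW.
Qed.

Definition laurent_of_upoly (p : upoly 'End(V)) : laurent :=
  Laurent (laurent_of_upoly_subproof p).

Definition laurent1 : laurent := laurent_of_upoly (umonom \1%VF 0).

Lemma laurent_mul_subproof (c d : laurent) :
  (fun n : int => \sum_(i \in [set: int]) (c i \o d (n - i))%VF)
    \in bounded_above.
Proof.
have [N cN] := laurent_bound c; have [P dP] := laurent_bound d.
apply/asboolP; exists (N + P) => k NPk; apply: fsbig1 => i _.
have [Ni|iN] := ltP N i; first by rewrite cN // comp_lfun0l.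
by rewrite dP ?comp_lfun0r// ltrBrDl (le_lt_trans _ NPk)// lerD2r.
Qed.

(* Finitely many summands are nonzero in each degree. *)
Definition laurent_mul (c d : laurent) : laurent :=
  Laurent (laurent_mul_subproof c d).

(* The two-sided inverse, 0 by convention if c is not invertible *)
Definition laurent_inv (c : laurent) : laurent :=
  xget 0 [set d | laurent_mul c d = laurent1 /\ laurent_mul d c = laurent1].

(* The residue at infinity of the differential form c du *)
Definition res_infty (c : laurent) : 'End(V) := - c (- 1).

End LaurentSeriesAtInfinity.

Section Trace.
Variables (K : fieldType) (W : lmodType K).

Definition is_basis n (b : 'I_n -> W) :=
  forall w : W, exists! c : 'rV[K]_n, w = \sum_i c 0 i *: b i.

(* A is the matrix of f in the basis b, acting on columns of coordinates. *)
Definition is_matrix_of n (b : 'I_n -> W) (f : W -> W) (A : 'M[K]_n) :=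
  forall j, f (b j) = \sum_i A i j *: b i.

(* The trace of a linear endomorphism f, computed in any finite basis of W (see
   [lmod_traceE]); it is 0 by convention if W is infinite-dimensional. *)
Definition lmod_trace (f : W -> W) : K :=
  xget 0 [set t | exists n (b : 'I_n -> W) (A : 'M[K]_n),
    [/\ is_basis b, is_matrix_of b f A & t = \tr A]].

Lemma is_basis_free n (b : 'I_n -> W) (c d : 'rV[K]_n) : is_basis b ->
  \sum_i c 0 i *: b i = \sum_i d 0 i *: b i -> c = d.
Proof.
move=> /(_ (\sum_i c 0 i *: b i))[e [_ eu]] cd.
by rewrite -(eu c) // (eu d).
Qed.

Lemma is_basis_coord n (b : 'I_n -> W) p (v : 'I_p -> W) : is_basis b ->
  exists P : 'M[K]_(n, p), forall j, v j = \sum_i P i j *: b i.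
Proof.
move=> bb; have /choice[c vc] : forall j, exists c : 'rV[K]_n,
    v j = \sum_i c 0 i *: b i by move=> j; have [c []] := bb (v j); exists c.
exists (\matrix_(i, j) c j 0 i) => j; rewrite vc.
by apply: eq_bigr => i _; rewrite mxE.
Qed.

Lemma is_basis_inj n (b : 'I_n -> W) p (P Q : 'M[K]_(n, p)) : is_basis b ->
  (forall j, \sum_i P i j *: b i = \sum_i Q i j *: b i) -> P = Q.
Proof.
move=> bb PQ; apply/matrixP => i j.
suff /rowP/(_ i) : \row_i P i j = \row_i Q i j by rewrite !mxE.
apply: (is_basis_free bb); rewrite (eq_bigr (fun i => P i j *: b i)).
  by rewrite PQ; apply: eq_bigr => k _; rewrite mxE.
by move=> k _; rewrite mxE.
Qed.

Lemma is_basis_mulmx n (b : 'I_n -> W) p (b' : 'I_p -> W) (P : 'M[K]_(n, p)) q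
    (Q : 'M[K]_(p, q)) : (forall j, b' j = \sum_i P i j *: b i) ->
  forall j, \sum_i (P *m Q) i j *: b i = \sum_k Q k j *: b' k.
Proof.
move=> b'E j; under [RHS]eq_bigr do rewrite b'E scaler_sumr.
rewrite exchange_big; apply: eq_bigr => i _; rewrite mxE scaler_suml.
by apply: eq_bigr => k _; rewrite scalerA mulrC.
Qed.

Lemma lmod_traceE (f : {linear W -> W}) n (b : 'I_n -> W) (A : 'M[K]_n) :
  is_basis b -> is_matrix_of b f A -> lmod_trace f = \tr A.
Proof.
move=> bb fA; apply: xget_unique => [|_ [p [b' [A' [bb' fA' ->]]]]].
  by exists n, b, A.
have [P b'E] := is_basis_coord b' bb; have [Q bE] := is_basis_coord b bb'.
have one k (e : 'I_k -> W) j : e j = \sum_i (1%:M : 'M[K]_k) i j *: e i.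
  rewrite (bigD1 j) //= mxE eqxx scale1r big1 ?addr0// => i /negPf ij.
  by rewrite mxE ij scale0r.
have QP1 : Q *m P = 1%:M.
  by apply: (is_basis_inj bb') => j; rewrite (is_basis_mulmx _ bE) -one b'E.
have PQ1 : P *m Q = 1%:M.
  by apply: (is_basis_inj bb) => j; rewrite (is_basis_mulmx _ b'E) -one bE.
have AP : A *m P = P *m A'.
  apply: (is_basis_inj bb) => j; rewrite (is_basis_mulmx _ fA).
  rewrite (is_basis_mulmx _ b'E) -fA' b'E linear_sum.
  by apply: eq_bigr => i _; rewrite linearZ.
by rewrite -[A']mul1mx -QP1 -mulmxA -AP mxtrace_mulC -mulmxA PQ1 mulmx1.
Qed.

End Trace.

Section TraceFormula.
Variables (K : fieldType) (V : vectType K).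
Implicit Types (g h : upoly 'End(V)) (v : upoly V).

Lemma umul_subproof h v :
  (fun n => \sum_(i < n.+1) h i (v (n - i)%N)) \in @finite_degree K V.
Proof.
have [p hp] := upoly_degree h; have [q vq] := upoly_degree v.
apply/asboolP; exists (p + q)%N => k pqk; apply: big1 => i _.
have [pi|ip] := leqP p i; first by rewrite hp// zero_lfunE.
have qki : (q <= k - i)%N by rewrite -(addKn p q) leq_sub// ltnW.
by rewrite vq// linear0.
Qed.

(* h v, for the left action of End(V)[u] on V[u] in which u is central *)
Definition umul h v : upoly V := UPoly (umul_subproof h v).

Lemma umul_is_linear h : linear (umul h).
Proof.
move=> a v w; apply/upolyP => n.
rewrite -[RHS]/(a *: umul h v n + umul h w n) scaler_sumr -big_split /=.
by apply: eq_bigr => i _; rewrite -linearP.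
Qed.

HB.instance Definition _ h :=
  GRing.isLinear.Build K (upoly V) (upoly V) _ (umul h) (umul_is_linear h).

(* gV[u] *)
Definition umul_image g : {pred upoly V} :=
  [pred w : upoly V | `[< exists v, w = umul g v >]].

Lemma umul_image_closed g : submod_closed (umul_image g).
Proof.
split=> [|a _ _ /asboolP[v ->] /asboolP[w ->]]; apply/asboolP.
  by exists 0; rewrite linear0.
by exists (a *: v + w); rewrite linearP.
Qed.

HB.instance Definition _ g := GRing.isSubmodClosed.Build K (upoly V)
  (umul_image g) (umul_image_closed g).

(* V[u]/gV[u], as MathComp's quotient of a Z-module by a subgroup, to which the
   scaling by K is added below *)
Definition coker g := Quotient.quot (umul_image g).

HB.instance Definition _ g := EqQuotient.on (coker g).
HB.instance Definition _ g := GRing.Zmodule.on (coker g).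

Definition proj g v : coker g := \pi_(coker g) v.

Lemma projP g v w : (proj g v = proj g w) <-> exists z, v - w = umul g z.
Proof.
split=> [/eqP|vw]; last apply/eqP; rewrite -Quotient.idealrBE.
  by move=> /asboolP.
exact/asboolP.
Qed.

Lemma proj_repr g (x : coker g) : proj g (repr x) = x.
Proof. exact: reprK. Qed.

Lemma projD g : {morph proj g : v w / v + w}.
Proof. by move=> v w; rewrite /proj !piE. Qed.

Definition coker_scale g a (x : coker g) : coker g := proj g (a *: repr x).

Lemma coker_scaleE g a v : coker_scale a (proj g v) = proj g (a *: v).
Proof.
have /projP[z vz] := proj_repr (proj g v).
by apply/projP; exists (a *: z); rewrite -scalerBr vz linearZ.
Qed.

Lemma coker_scaleA g a b (x : coker g) :
  coker_scale a (coker_scale b x) = coker_scale (a * b) x.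
Proof. by rewrite -[x]proj_repr !coker_scaleE scalerA. Qed.

Lemma coker_scale1 g : left_id 1 (@coker_scale g).
Proof. by move=> x; rewrite -[x]proj_repr coker_scaleE scale1r. Qed.

Lemma coker_scaleDr g : right_distributive (@coker_scale g) +%R.
Proof.
move=> a x y; rewrite -[x]proj_repr -[y]proj_repr -projD.
by rewrite !coker_scaleE scalerDr projD.
Qed.

Lemma coker_scaleDl g (x : coker g) :
  {morph (@coker_scale g)^~ x : a b / a + b}.
Proof.
by move=> a b; rewrite -[x]proj_repr !coker_scaleE scalerDl projD.
Qed.

HB.instance Definition _ g := GRing.Zmodule_isLmodule.Build K (coker g)
  (@coker_scaleA g) (@coker_scale1 g) (@coker_scaleDr g) (@coker_scaleDl g).

Lemma proj_is_linear g : linear (proj g).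
Proof. by move=> a v w; rewrite projD -coker_scaleE. Qed.

HB.instance Definition _ g :=
  GRing.isLinear.Build K (upoly V) (coker g) _ (proj g) (proj_is_linear g).

(* For g of degree m with invertible leading coefficient, each class has exactly
   one representative in V + Vu + ... + Vu^(m-1). *)
Definition sigma g (m : nat) (x : coker g) : upoly V :=
  xget 0 [set v : upoly V | (forall k, (m <= k)%N -> v k = 0) /\ proj g v = x].

Definition phi g (m : nat) h (x : coker g) : coker g :=
  proj g (umul h (sigma m x)).

End TraceFormula.

(* Main.v *)
Require Import Defs.
From HB Require Import structures.
From mathcomp Require Import all_boot all_order all_algebra.
From mathcomp Require Import all_classical.
From mathcomp Require Import zify.

(* Write G = g^-1 = \sum_n G_n u^n. The representative of degree < m of the
   class of w in V[u]/gV[u] is g [G w]_{<0}, where [ ]_{<0} keeps the negative powers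
   of u; its coefficient of u^l is \sum_(i > l) \sum_k g_i G_(l-i-k) w_k. For
   w = h x u^j this shows that the j-th diagonal block of phi(h) is
   \sum_(i > j) \sum_k g_i G_(-i-k) h_k. Summing over j < m multiplies the i-th
   term by i and gives the coefficient of u^-1 in g' G h. *)

Set Implicit Arguments.
Unset Strict Implicit.
Unset Printing Implicit Defensive.

Import Order.TTheory GRing.Theory Num.Theory.
Local Open Scope ring_scope.

(** * Inverting power series over a ring *)

Lemma course_of_values_rec (T : Type) (x0 : T) (F : nat -> (nat -> T) -> T) :
  (forall n s t, (forall i, (i <= n)%N -> s i = t i) -> F n s = F n t) ->
  exists s, s 0%N = x0 /\ forall n, s n.+1 = F n s.
Proof.
move=> F_local.
(* [S n] is correct up to index n and later stages no longer change it there; the solution is the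
   diagonal. *)
pose step n s k := if k == n.+1 then F n s else s k.
pose S := fix S n := if n is k.+1 then step k (S k) else fun=> x0.
have SE n d i : (i <= n)%N -> S (n + d)%N i = S n i.
  elim: d => [|d IHd] ni; first by rewrite addn0.
  by rewrite addnS /= /step ltn_eqF ?IHd// ltnS (leq_trans ni)// leq_addr.
exists (fun n => S n n); split=> // n; rewrite [LHS]/= /step eqxx.
by apply: F_local => i ni; rewrite -(subnKC ni) SE.
Qed.

(** Both sides run over the pairs with i + j < n. *)
Lemma triangle_exchange (R : nmodType) n (F : nat -> nat -> R) :
  \sum_(i < n) \sum_(j < n - i) F i j = \sum_(j < n) \sum_(i < n - j) F i j.
Proof.
have widen (E : nat -> nat -> R) :
    \sum_(i < n) \sum_(j < n - i) E i j =
    \sum_(i < n) \sum_(j < n | (i + j < n)%N) E i j.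
  apply: eq_bigr => i _; rewrite (big_ord_widen _ _ (leq_subr i n)).
  by apply: eq_bigl => j; rewrite ltn_subRL.
rewrite widen (widen (fun j i => F i j)) (exchange_big_dep predT) //=.
by apply: eq_bigr => j _; apply: eq_bigl => i; rewrite addnC.
Qed.

(** Applied to the coefficients of g in reverse order, this inverts g up to a power of u. The
    coefficients need not commute, hence the two identities. *)
Lemma series_inverse (R : pzRingType) (a : nat -> R) (b : R) :
  a 0%N * b = 1 -> b * a 0%N = 1 ->
  exists s : nat -> R, forall n,
    \sum_(i < n.+1) a i * s (n - i)%N = (n == 0%N)%:R /\
    \sum_(i < n.+1) s (n - i)%N * a i = (n == 0%N)%:R.
Proof.
move=> ab ba.
have [|s [s0 sS]] := @course_of_values_rec R b
    (fun n s => - (b * \sum_(i < n.+1) a i.+1 * s (n - i)%N)).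
  move=> n s t st; congr (- (_ * _)).
  by apply: eq_bigr => i _; rewrite st ?leq_subr.
(* The recursion makes s a right inverse; this mirror recursion makes it a left
   inverse. *)
have sS' n : s n.+1 = - ((\sum_(i < n.+1) s (n - i)%N * a i.+1) * b).
  elim/ltn_ind: n => n IHn.
  (* The terms i = n agree: both are b a_(n+1) b. In the others, expanding s_(n-i) by the mirror
     recursion on the left and by the defining one on the right gives the same sum over i + j <
     n. *)
  rewrite sS !big_ord_recr /= subnn s0 mulrDr mulrDl mulrA.
  congr (- (_ + _)); rewrite mulr_sumr mulr_suml.
  transitivity (- \sum_(i < n) \sum_(j < n - i)
      b * a i.+1 * s (n - i - j.+1)%N * a j.+1 * b).
    rewrite -sumrN; apply: eq_bigr => i _.
    have [k nik] : exists k, (n - i)%N = k.+1.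
      by exists (n - i).-1; rewrite prednK// subn_gt0.
    rewrite nik IHn; last by rewrite -ltnS -nik ltnS leq_subr.
    rewrite !mulrN mulr_suml !mulr_sumr; congr (- _).
    by apply: eq_bigr => j _; rewrite subSS !mulrA.
  rewrite (triangle_exchange n
    (fun i j => b * a i.+1 * s (n - i - j.+1)%N * a j.+1 * b)).
  rewrite -sumrN; apply: eq_bigr => j _.
  have [k njk] : exists k, (n - j)%N = k.+1.
    by exists (n - j).-1; rewrite prednK// subn_gt0.
  rewrite njk sS !mulNr mulr_sumr !mulr_suml; congr (- _).
  apply: eq_bigr => i _; rewrite !mulrA; congr (_ * s _ * _ * _).
  by rewrite -subnDA addnC addSnnS subnDA njk subSS.
exists s => -[|n]; first by rewrite !big_ord1 s0.
split; rewrite big_ord_recl subn0.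
  by rewrite sS mulrN mulrA ab mul1r addrC; apply/eqP; rewrite subr_eq0.
by rewrite sS' mulNr -mulrA ba mulr1 addrC; apply/eqP; rewrite subr_eq0.
Qed.

(** * Traces in coordinates *)

(** The index type is arbitrary because the basis of V[u]/gV[u] is indexed by pairs; linearity is a
    plain hypothesis because that of [phi] is proved only under assumptions on g. *)
Lemma lmod_trace_coord (K : fieldType) (W : lmodType K) (I : finType)
    (e : I -> W) (co : I -> W -> K) (f : W -> W) :
  (forall w, w = \sum_i co i w *: e i) ->
  (forall (c : I -> K) i, co i (\sum_j c j *: e j) = c i) ->
  linear f -> lmod_trace f = \sum_i co i (f (e i)).
Proof.
move=> coE coK lf.
pose F : {linear W -> W} := HB.pack f (GRing.isLinear.Build _ _ _ _ f lf).
pose b (p : 'I_#|I|) := e (enum_val p).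
pose A := \matrix_(p < #|I|, q < #|I|) co (enum_val p) (f (b q)).
have sum_b (c : I -> K) : \sum_i c i *: e i = \sum_p c (enum_val p) *: b p.
  by rewrite (reindex _ (onW_bij _ (enum_val_bij I))).
have b_basis : is_basis b.
  move=> w; exists (\row_p co (enum_val p) w); split.
    by rewrite [LHS]coE sum_b; apply: eq_bigr => p _; rewrite mxE.
  move=> c wE; apply/rowP => p; rewrite mxE wE.
  rewrite (eq_bigr (fun q => c 0 (enum_rank (enum_val q)) *: b q)).
    by rewrite -(sum_b (fun i => c 0 (enum_rank i))) coK enum_valK.
  by move=> q _; rewrite enum_valK.
have fA : is_matrix_of b F A.
  move=> q; rewrite [LHS]coE sum_b.
  by apply: eq_bigr => p _; rewrite mxE.
rewrite (lmod_traceE b_basis fA : lmod_trace f = _) /mxtrace.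
rewrite (reindex _ (onW_bij _ (enum_val_bij I))).
by apply: eq_bigr => p _; rewrite mxE.
Qed.

Lemma lmod_trace_lfun (K : fieldType) (V : vectType K) (f : 'End(V)) :
  lmod_trace f =
  \sum_t coord (vbasis fullv) t (f (tnth (vbasis fullv) t)).
Proof.
apply: (lmod_trace_coord (e := tnth (vbasis fullv))
  (co := coord (vbasis fullv))); last exact: linearP.
  move=> w; rewrite {1}(coord_vbasis (memvf w)).
  by apply: eq_bigr => t _; rewrite -tnth_nth.
move=> c t; rewrite (eq_bigr (fun j => c j *: (vbasis fullv)`_j)).
  by rewrite coord_sum_free// (basis_free (vbasisP _)).
by move=> j _; rewrite (tnth_nth 0).
Qed.

(** * Products of a Laurent series and a polynomial *)

Section LaurentProducts.
Variables (K : fieldType) (V : vectType K).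
Implicit Types (p : upoly 'End(V)) (d : laurent V).

(** The sum over Z that defines [laurent_mul] becomes a finite one when a factor is a polynomial. *)
Lemma fsum_nonneg (R : nmodType) (F : int -> R) N :
  (forall i : int, (forall k, (k < N)%N -> i != k%:Z) -> F i = 0) ->
  \sum_(i \in [set: int]) F i = \sum_(k < N) F k%:Z.
Proof.
move=> F0; rewrite (fsbigE (map Posz (iota 0 N))) //.
- rewrite (eq_bigl xpredT); last by move=> i; rewrite in_setT.
  by rewrite big_map -[N in iota _ N]subn0 big_mkord.
- by rewrite map_inj_uniq ?iota_uniq// => i j [].
move=> i _ iN; apply: F0 => k kN; apply: contraNneq iN => ->.
by rewrite map_f// mem_iota.
Qed.

Lemma laurent_of_upoly_nonneg p N : (forall k, (N <= k)%N -> p k = 0) ->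
  forall i : int, (forall k, (k < N)%N -> i != k%:Z) ->
  laurent_of_upoly p i = 0.
Proof.
move=> pN [k|//] ik /=; apply: pN; rewrite leqNgt; apply/negP => /ik.
by rewrite eqxx.
Qed.

Lemma laurent_mul_upolyl p d N n : (forall k, (N <= k)%N -> p k = 0) ->
  laurent_mul (laurent_of_upoly p) d n = \sum_(i < N) (p i \o d (n - i%:Z))%VF.
Proof.
move=> pN; rewrite [LHS](@fsum_nonneg _ _ N)// => i iN.
by rewrite (laurent_of_upoly_nonneg pN iN) comp_lfun0l.
Qed.

Lemma laurent_mul_upolyr d p N n : (forall k, (N <= k)%N -> p k = 0) ->
  laurent_mul d (laurent_of_upoly p) n = \sum_(k < N) (d (n - k%:Z) \o p k)%VF.
Proof.
move=> pN; rewrite [LHS](reindex_fsbigT (fun i : int => n - i)).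
  2: by exists (fun i => n - i) => i; rewrite subKr.
rewrite (@fsum_nonneg _ _ N).
  by apply: eq_bigr => k _; rewrite /= subKr.
by move=> i iN; rewrite subKr (laurent_of_upoly_nonneg pN iN) comp_lfun0r.
Qed.

End LaurentProducts.

(* In contrast with [lfun_comp_nzRingType], this does not require V <> 0. *)
Definition lfun_comp_pzRingType (K : fieldType) (V : vectType K) : pzRingType :=
  HB.pack 'End(V) (GRing.Zmodule_isPzRing.Build 'End(V)
    (@comp_lfunA _ _ _ _ _) (@comp_lfun1l _ _ _) (@comp_lfun1r _ _ _)
    (@comp_lfunDl _ _ _ _) (@comp_lfunDr _ _ _ _)).

(** * The inverse of g in End(V)((u^-1)) *)

Section Division.
Variables (K : fieldType) (V : vectType K).
Variables (g : upoly 'End(V)) (m : nat) (b : 'End(V)).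
Hypothesis g_deg : forall k, (m < k)%N -> g k = 0.
Hypotheses (gb : (g m \o b = \1)%VF) (bg : (b \o g m = \1)%VF).

Section InverseFromSeries.
Variable s : nat -> 'End(V).

(** g = u^m \sum_i revcoef_i u^(-i), a power series in u^-1 with invertible constant term g_m; s
    will be its inverse. *)
Let revcoef i : 'End(V) := if (i <= m)%N then g (m - i)%N else 0.

Lemma shifted_series_subproof :
  (fun n : int => if n <= - m%:Z then s (absz (n + m%:Z)) else 0)
    \in @bounded_above K V.
Proof. by apply/asboolP; exists (- m%:Z) => k; rewrite ltNge => /negPf->. Qed.

(* \sum_p s_p u^(-m-p) *)
Definition shifted_series : laurent V := Laurent shifted_series_subproof.

Lemma shifted_series_coef p i : (i <= m)%N ->
  shifted_series (- p%:Z - (m - i)%N%:Z) =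
  if (i <= p)%N then s (p - i)%N else 0.
Proof.
move=> im /=; have [ip|pi] := leqP i p; last by rewrite ifF//; lia.
by rewrite ifT; [congr s|]; lia.
Qed.

Lemma shifted_series_coef_pos n i : (i <= m)%N ->
  shifted_series (n.+1%:Z - (m - i)%N%:Z) = 0.
Proof. by move=> im /=; rewrite ifF//; lia. Qed.

(** The product with g has terms for i <= m, the convolution for i <= p; zeros extend both ranges to
    i <= m + p. *)
Let truncate (F : nat -> 'End(V)) p : (forall i, (m < i)%N -> F i = 0) ->
  \sum_(i < m.+1) (if (i <= p)%N then F i else 0) = \sum_(i < p.+1) F i.
Proof.
move=> F0; rewrite (big_ord_widen (m + p).+1
  (fun i => if (i <= p)%N then F i else 0)); last by rewrite ltnS leq_addr.
rewrite [RHS](big_ord_widen (m + p).+1 F); last by rewrite ltnS leq_addl.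
rewrite big_mkcond [RHS]big_mkcond; apply: eq_bigr => i _; rewrite !ltnS.
by case: (leqP i m) => // /F0 ->; case: ifP.
Qed.

Let rev_ordSE (i : 'I_m.+1) : rev_ord i = (m - i)%N :> nat.
Proof. exact: subSS. Qed.

Let laurent1_neg p :
  laurent1 V (- p%:Z) = if p == 0%N then \1%VF else 0.
Proof. by case: p. Qed.

Let int_cases (n : int) : (exists k, n = k.+1%:Z) \/ (exists p, n = - p%:Z).
Proof.
case: n => [[|k]|k]; [right; exists 0%N | left; exists k | right; exists k.+1];
  by rewrite ?NegzE.
Qed.

(** Summed in reverse, the coefficient of u^(-p) is the p-th convolution of [revcoef] and s;
    positive degrees vanish. *)
Lemma laurent_mul_shifted_series :
  (forall n, \sum_(i < n.+1) (revcoef i \o s (n - i))%VF =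
    if n == 0%N then \1%VF else 0) ->
  laurent_mul (laurent_of_upoly g) shifted_series = laurent1 V.
Proof.
move=> as1; apply/val_inj/funext => n.
rewrite [LHS](laurent_mul_upolyl _ _ (N := m.+1)) // (reindex_inj rev_ord_inj).
have [[k ->]|[p ->]] := int_cases n.
  apply: big1 => i _; rewrite rev_ordSE shifted_series_coef_pos ?leq_ord//.
  by rewrite comp_lfun0r.
rewrite [RHS]laurent1_neg -as1
  -(@truncate (fun i => revcoef i \o s (p - i))%VF) => [|i mi]; last first.
  by rewrite /revcoef leqNgt mi comp_lfun0l.
apply: eq_bigr => i _; rewrite rev_ordSE shifted_series_coef ?leq_ord//.
by rewrite /revcoef leq_ord; case: ifP => // _; rewrite comp_lfun0r.
Qed.

Lemma shifted_series_laurent_mul :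
  (forall n, \sum_(i < n.+1) (s (n - i) \o revcoef i)%VF =
    if n == 0%N then \1%VF else 0) ->
  laurent_mul shifted_series (laurent_of_upoly g) = laurent1 V.
Proof.
move=> sa1; apply/val_inj/funext => n.
rewrite [LHS](laurent_mul_upolyr _ _ (N := m.+1)) // (reindex_inj rev_ord_inj).
have [[k ->]|[p ->]] := int_cases n.
  apply: big1 => i _; rewrite rev_ordSE shifted_series_coef_pos ?leq_ord//.
  by rewrite comp_lfun0l.
rewrite [RHS]laurent1_neg -sa1
  -(@truncate (fun i => s (p - i) \o revcoef i)%VF) => [|i mi]; last first.
  by rewrite /revcoef leqNgt mi comp_lfun0r.
apply: eq_bigr => i _; rewrite rev_ordSE shifted_series_coef ?leq_ord//.
by rewrite /revcoef leq_ord; case: ifP => // _; rewrite comp_lfun0l.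
Qed.

End InverseFromSeries.

Lemma laurent_mulV :
  laurent_mul (laurent_of_upoly g) (laurent_inv (laurent_of_upoly g)) =
  laurent1 V.
Proof.
have [||s sP] := @series_inverse (lfun_comp_pzRingType V)
    (fun i => if (i <= m)%N then g (m - i)%N else 0) b.
- by rewrite leq0n subn0; exact: gb.
- by rewrite leq0n subn0; exact: bg.
(* [xget] returns a genuine inverse, since [shifted_series s] shows that there is one. *)
rewrite /laurent_inv; case: xgetP => [d _ []//|/(_ (shifted_series s))[]].
split.
  apply: laurent_mul_shifted_series => n; rewrite [LHS](sP n).1.
  by case: (n).
apply: shifted_series_laurent_mul => n; rewrite [LHS](sP n).2.
by case: (n).
Qed.

Lemma laurent_inv_coef (n : int) :
  \sum_(i < m.+1) (g i \o laurent_inv (laurent_of_upoly g) (n - i%:Z))%VF =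
  if n == 0 then \1%VF else 0.
Proof.
rewrite -laurent_mul_upolyl// laurent_mulV.
by case: n => -[].
Qed.

(** * Division by g with remainder *)

Lemma umulE (h : upoly 'End(V)) (v : upoly V) n :
  umul h v n = \sum_(i < n.+1) h i (v (n - i)%N).
Proof. by []. Qed.

(** As g_m is invertible, multiplication by g raises degrees by exactly m; hence a class has at most
    one representative of degree < m. *)
Lemma umul_deg_eq0 (z : upoly V) :
  (forall k, (m <= k)%N -> umul g z k = 0) -> z = 0.
Proof.
move=> gz0; have [N zN] := upoly_degree z.
suff z0 n : (n <= N)%N -> forall k, (N - n <= k)%N -> z k = 0.
  by apply/upolyP => k; rewrite (z0 N)// subnn.
elim: n => [_ k|n IHn nN k]; first by rewrite subn0; exact: zN.
rewrite leq_eqVlt => /predU1P[<-{k}|]; last first.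
  by rewrite subnSK//; apply: IHn; exact: ltnW.
(* In degree m + k only g_m z_k is left: g_i = 0 for i > m, and i < m meets a coefficient of z above
   k, zero by induction. *)
set k := (N - n.+1)%N; have := gz0 (m + k)%N (leq_addr _ _).
rewrite umulE (bigD1 (inord m)) //= inordK; last first.
  by rewrite ltnS leq_addr.
rewrite addKn big1 ?addr0 => [gzk|i im].
  by rewrite -[z k]id_lfunE -bg comp_lfunE gzk linear0.
case: (ltngtP m i) => [mi|im'|mi].
- by rewrite g_deg// zero_lfunE.
- rewrite (IHn (ltnW nN)) ?linear0// -subnSK// -/k.
  by rewrite -addnBAC ?(ltnW im')// -addn1 addnC leq_add2r subn_gt0.
- by case/eqP: im; apply/val_inj; rewrite /= inordK// ltnS leq_addr.
Qed.

Lemma sigma_proj (v : upoly V) : (forall k, (m <= k)%N -> v k = 0) ->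
  sigma m (Defs.proj g v) = v.
Proof.
move=> v_deg; apply: xget_unique => // w [w_deg /projP[z wvz]].
apply/eqP; rewrite -subr_eq0 wvz [z]umul_deg_eq0 ?linear0// => k mk.
by rewrite -wvz -[LHS]/(w k - v k) w_deg ?v_deg ?subrr.
Qed.

(** Since v = g (G v), subtracting g times the nonnegative part of G v leaves g [G v]_{<0}; the
    terms i > l are those with l - i negative. *)
Lemma remainder (v : upoly V) N : (forall k, (N <= k)%N -> v k = 0) ->
  exists2 r : upoly V, Defs.proj g r = Defs.proj g v & forall l, r l =
    \sum_(i < m.+1 | (l < i)%N) g i (\sum_(k < N)
      laurent_inv (laurent_of_upoly g) (l%:Z - i%:Z - k%:Z) (v k)).
Proof.
move=> vN; set G := laurent_inv _.
pose Gv (l : int) := \sum_(k < N) G (l - k%:Z) (v k).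
(* The coefficients of G v in degrees l >= 0 form the quotient, a polynomial since G is bounded
   above. *)
have q_deg : (fun l : nat => Gv l) \in @finite_degree K V.
  have [D GD] := laurent_bound G; apply/asboolP; exists (N + absz D).+1 => l.
  by move=> lD; apply: big1 => k _; rewrite GD ?zero_lfunE//;
    have := ltn_ord k; lia.
have gG (l k : nat) x : \sum_(i < m.+1) g i (G (l%:Z - i%:Z - k%:Z) x) =
    if l == k then x else 0.
  transitivity ((\sum_(i < m.+1) (g i \o G (l%:Z - k%:Z - i%:Z))%VF) x).
    by rewrite sum_lfunE; apply: eq_bigr => i _; rewrite comp_lfunE addrAC.
  rewrite laurent_inv_coef subr_eq0 eqz_nat.
  by case: ifP; rewrite ?id_lfunE ?zero_lfunE.
have v_gGv (l : nat) : v l = \sum_(i < m.+1) g i (Gv (l%:Z - i%:Z)).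
  under eq_bigr do rewrite linear_sum.
  rewrite exchange_big /=; under eq_bigr do rewrite gG.
  rewrite -big_mkcond /=; have [lN|Nl] := ltnP l N.
    by rewrite (big_pred1 (Ordinal lN)).
  by rewrite vN// big_pred0// => k; rewrite gtn_eqF// (leq_trans (ltn_ord k)).
exists (v - umul g (UPoly q_deg)).
  apply/projP; exists (- UPoly q_deg).
  by rewrite linearN /= addrAC subrr add0r.
move=> l; rewrite -[LHS]/(v l - umul g (UPoly q_deg) l) v_gGv.
(* The terms i <= l make up the coefficient of u^l in g times the quotient, up to zeros g_i with i >
   m. *)
rewrite (bigID (fun i : 'I_m.+1 => (l < i)%N)) /=.
apply/eqP; rewrite -addrA -[eqbRHS]addr0 (inj_eq (addrI _)) subr_eq0; apply/eqP.
rewrite (big_ord_widen_cond (maxn m l).+1 (fun i => ~~ (l < i)%N)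
  (fun i => g i (Gv (l%:Z - i%:Z)))) ?ltnS ?leq_maxl//.
rewrite (big_ord_widen (maxn m l).+1
  (fun i => g i (Gv (l - i)%N))) ?ltnS ?leq_maxr//.
rewrite big_mkcond [RHS]big_mkcond; apply: eq_bigr => i _.
rewrite -leqNgt !ltnS.
have [il|//] := leqP i l; rewrite subzn//.
by case: leqP => // /g_deg->; rewrite zero_lfunE.
Qed.

Lemma sigma_proj_coef (v : upoly V) N l : (forall k, (N <= k)%N -> v k = 0) ->
  sigma m (Defs.proj g v) l = \sum_(i < m.+1 | (l < i)%N) g i (\sum_(k < N)
      laurent_inv (laurent_of_upoly g) (l%:Z - i%:Z - k%:Z) (v k)).
Proof.
move=> /remainder[r <- rE]; rewrite sigma_proj// => k mk.
(* In degrees k >= m no i <= m exceeds k, so the remainder has degree < m and is the value of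
   [sigma]. *)
rewrite rE big_pred0// => i.
by apply/negbTE; rewrite -leqNgt (leq_trans _ mk)// leq_ord.
Qed.

(** [remainder] provides a representative of degree < m, so the [xget] in [sigma] does not fall back
    on its default. *)
Lemma sigmaP (x : coker g) :
  (forall k, (m <= k)%N -> sigma m x k = 0) /\ Defs.proj g (sigma m x) = x.
Proof.
have [N xN] := upoly_degree (repr x).
have [r rx rE] := remainder xN; rewrite -[x]proj_repr -rx.
have r_deg k : (m <= k)%N -> r k = 0.
  move=> mk; rewrite rE big_pred0// => i.
  by apply/negbTE; rewrite -leqNgt (leq_trans _ mk)// leq_ord.
by rewrite sigma_proj.
Qed.

Lemma sigma_is_linear : linear (@sigma K V g m).
Proof.
move=> a x y; have [x_deg xK] := sigmaP x; have [y_deg yK] := sigmaP y.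
rewrite -[in LHS]xK -[in LHS]yK -linearP sigma_proj// => k mk.
by rewrite -[LHS]/(a *: sigma m x k + sigma m y k) x_deg ?y_deg// scaler0 addr0.
Qed.

(** * The trace of phi(h) and the residue *)

Local Notation e := (vbasis (fullv : {vspace V})).

Lemma sum_upolyE (M : lmodType K) I (r : seq I) P (F : I -> upoly M) k :
  (\sum_(i <- r | P i) F i) k = \sum_(i <- r | P i) F i k.
Proof. by elim/big_rec2: _ => // i x y _ <-. Qed.

(** The classes of these e_t u^j, j < m, are the basis in which the trace of [phi] is taken. *)
Let monom (jt : 'I_m * 'I_(\dim {:V})) := umonom (tnth e jt.2) jt.1.

Let sum_monom_coef (c : 'I_m * 'I_(\dim {:V}) -> K) (j : 'I_m) :
  (\sum_jt c jt *: monom jt) j = \sum_t c (j, t) *: tnth e t.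
Proof.
transitivity (\sum_(i < m) \sum_t (c (i, t) *: monom (i, t)) j).
  by rewrite sum_upolyE pair_bigA; apply: eq_bigr => -[].
rewrite (bigD1 j) //= [X in _ + X]big1 ?addr0 => [|i ij].
  by apply: eq_bigr => t _; rewrite [LHS]/= /( *:%R ) /= eqxx.
apply: big1 => t _; apply: (_ : c (i, t) *: (if _ then _ else _) = _).
by rewrite ifF ?scaler0// eq_sym; apply: negbTE.
Qed.

(** The (j, t) coordinate of a class is the e_t coordinate of the u^j coefficient of its
    representative; e_t u^j represents its own class, which [phi] therefore sends to that of h e_t
    u^j. *)
Lemma lmod_trace_phi (h : upoly 'End(V)) :
  lmod_trace (@phi K V g m h) =
  \sum_(j < m) \sum_t coord e t
    (sigma m (Defs.proj g (umul h (umonom (tnth e t) j))) j).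
Proof.
have monom_deg (c : 'I_m * 'I_(\dim {:V}) -> K) k : (m <= k)%N ->
    (\sum_jt c jt *: monom jt) k = 0.
  move=> mk; rewrite sum_upolyE big1// => jt _.
  rewrite -[LHS]/(c jt *: (if k == jt.1 then _ else 0)) gtn_eqF ?scaler0//.
  exact: leq_trans (ltn_ord _) mk.
rewrite (lmod_trace_coord (e := fun jt => Defs.proj g (monom jt))
  (co := fun jt x => coord e jt.2 (sigma m x jt.1))).
- rewrite pair_bigA; apply: eq_bigr => -[j t] _ /=.
  rewrite /phi [sigma m (Defs.proj g (monom _))]sigma_proj// => k mk.
  by rewrite /= gtn_eqF// (leq_trans (ltn_ord _) mk).
- move=> x; have [x_deg {1}<-] := sigmaP x.
  under eq_bigr do rewrite -linearZ; rewrite -linear_sum; congr Defs.proj.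
  apply/upolyP => k; have [km|mk] := ltnP k m; last by rewrite x_deg ?monom_deg.
  rewrite (sum_monom_coef _ (Ordinal km)) /=.
  rewrite {1}(coord_vbasis (memvf (sigma m x k))).
  by apply: eq_bigr => t _; rewrite -tnth_nth.
- move=> c [j t] /=; under eq_bigr do rewrite -linearZ; rewrite -linear_sum.
  rewrite sigma_proj; last by move=> k; apply: monom_deg.
  rewrite sum_monom_coef; under eq_bigr do rewrite (tnth_nth 0).
  by rewrite coord_sum_free// (basis_free (vbasisP _)).
by move=> a x y; rewrite /phi sigma_is_linear !linearP.
Qed.

Lemma umul_monom_coef (h : upoly 'End(V)) x j k :
  umul h (umonom x j) k = if (j <= k)%N then h (k - j)%N x else 0.
Proof.
rewrite umulE; have [jk|kj] := leqP j k; last first.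
  apply: big1 => i _ /=; rewrite ifF ?linear0//.
  by rewrite ltn_eqF// (leq_ltn_trans (leq_subr _ _)).
have kjk : (k - j < k.+1)%N by rewrite ltnS leq_subr.
rewrite (bigD1 (Ordinal kjk)) //= subKn// eqxx big1 ?addr0// => i ikj.
rewrite ifF ?linear0//; apply: contraNF ikj => /eqP ji.
by apply/eqP/val_inj; rewrite /= -ji subKn// -ltnS.
Qed.

(** h x u^j has coefficient h_k x in degree j + k, and j - i - (j + k) = -i - k: j survives only in
    the range i > j. *)
Lemma sigma_umul_monom (h : upoly 'End(V)) N x j :
  (forall k, (N <= k)%N -> h k = 0) ->
  sigma m (Defs.proj g (umul h (umonom x j))) j =
  \sum_(i < m.+1 | (j < i)%N) g i (\sum_(k < N)
    laurent_inv (laurent_of_upoly g) (- i%:Z - k%:Z) (h k x)).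
Proof.
move=> hN; rewrite (@sigma_proj_coef _ (j + N)); last first.
  move=> k jNk; rewrite umul_monom_coef; case: ifP => // _.
  by rewrite hN ?zero_lfunE// leq_subRL// (leq_trans _ jNk)// leq_addr.
apply: eq_bigr => i _; congr (g i _); rewrite big_split_ord.
rewrite big1 => [|k _]; last first.
  by rewrite umul_monom_coef ifF ?linear0// leqNgt /= ltn_ord.
rewrite [LHS]add0r; apply: eq_bigr => k _.
rewrite umul_monom_coef [(_ <= _)%N]leq_addr [(_ - j)%N]addKn.
congr (laurent_inv _ _ _); rewrite [nat_of_ord (rshift _ _)]/=; lia.
Qed.

Lemma trace_residue (h : upoly 'End(V)) :
  lmod_trace (@phi K V g m h) =
  - lmod_trace (res_infty (laurent_mul
      (laurent_mul (laurent_of_upoly (uderiv g))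
                   (laurent_inv (laurent_of_upoly g)))
      (laurent_of_upoly h))).
Proof.
rewrite lmod_trace_phi lmod_trace_lfun -sumrN exchange_big.
(* The sign in [res_infty] cancels the one in the formula. *)
apply: eq_bigr => t _; rewrite /res_infty opp_lfunE !linearN opprK.
rewrite -linear_sum; congr (coord _ _ _); set x := tnth _ t.
have [N hN] := upoly_degree h.
rewrite [LHS](eq_bigr _ (fun (j : 'I_m) _ => sigma_umul_monom x j hN)).
rewrite (exchange_big_dep predT) //.
set G := laurent_inv _.
(* As i <= m, exactly i of the indices j < m satisfy j < i; this is the factor that differentiation
   produces. *)
transitivity (\sum_(i < m.+1)
    g i (\sum_(k < N) G (- i%:Z - k%:Z) (h k x)) *+ i).
  apply: eq_bigr => i _; rewrite -(big_ord_widen m (fun=> _) (leq_ord i)).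
  by rewrite sumr_const card_ord.
(* The term i = 0 vanishes; the term i + 1 involves G in degree -(i + 1) - k = -1 - k - i and
   matches the coefficient of u^i in g'. *)
rewrite big_ord_recl mulr0n add0r (laurent_mul_upolyr _ _ hN) sum_lfunE.
under eq_bigr do rewrite linear_sum -sumrMnl.
rewrite exchange_big; apply: eq_bigr => k _.
rewrite comp_lfunE (@laurent_mul_upolyl _ _ _ _ m); last first.
  by move=> i mi; rewrite /= g_deg// mul0rn.
rewrite sum_lfunE; apply: eq_bigr => i _; rewrite comp_lfunE.
rewrite -[uderiv g i]/(g i.+1 *+ i.+1) -[in RHS]scaler_nat.
rewrite scale_lfunE scaler_nat.
by rewrite lift0; congr (g _ (G _ _) *+ _); lia.
Qed.

End Division.

Theorem proposition6p1 (K : fieldType) (charK : [pchar K] =i pred0)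
    (V : vectType K) (m : nat) (m_ge1 : (1 <= m)%N)
    (a : 'I_m.+1 -> 'End(V))
    (a0_invertible : exists2 b : 'End(V),
       (a ord0 \o b = \1)%VF & (b \o a ord0 = \1)%VF)
    (h : upoly 'End(V)) :
  let g : upoly 'End(V) := \sum_(i < m.+1) umonom (a i) (m - i) in
  lmod_trace (@phi K V g m h) =
  - lmod_trace (res_infty (laurent_mul
      (laurent_mul (laurent_of_upoly (uderiv g))
                   (laurent_inv (laurent_of_upoly g)))
      (laurent_of_upoly h))).
Proof.
case: a0_invertible => b ab ba g.
have gE k : g k = \sum_(i < m.+1) (if k == (m - i)%N then a i else 0).
  exact: sum_upolyE.
have gm : g m = a ord0.
  rewrite gE big_ord_recl subn0 eqxx big1 ?addr0// => i _.
  by rewrite gtn_eqF// lift0 -subn_gt0 subKn.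
apply: (@trace_residue _ _ _ _ b); rewrite ?gm// => k mk.
by rewrite gE big1// => i _; rewrite gtn_eqF// (leq_ltn_trans (leq_subr _ _)).
Qed.
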